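(* Assume that the kernel $K$ satisfies Assumptions (A1) and (A2) and, in addition, that $K\in C_c^\infty(\mathbb{R})$. Let $f\in L^2(\Omega)$ and $u\in L^2(\Omega\cup\Omega_I)$ satisfy $Lu=f$ in $\Omega$. Then $f$ satisfies Assumption (B) if and only if $u$ satisfies Assumption (B). Furthermore, $$[u^{(k)}]_0=-\frac{1}{\alpha}[f^{(k)}]_0,\qquad k=0,1,2,\ldots$$
   Context: Let $\Omega=(a_1,a_2)$ be a bounded open interval with $0\in\Omega$, $\delta>0$, and $\Omega_I=(a_1-\delta,a_1]\cup[a_2,a_2+\delta)$. The nonlocal operator is $Lu(x)=\int_{\Omega\cup\Omega_I}(u(y)-u(x))K(x,y)\,dy$, and $\alpha:=\|K\|_{L^1(\mathbb{R})}>0$. Assumption (A1): $K(x,y)=K(|x-y|)\ge 0$ for all $x,y\in\Omega\cup\Omega_I$ (one also writes $K(z)=K(|z|)$, an even function of $z\in\mathbb{R}$), $K(|x-y|)=0$ for $|x-y|\ge\delta$, and $K\in L^1(\mathbb{R})$. Assumption (A2): $K$ is continuous on $[-\delta,0)\cup(0,\delta]$ and $C^\infty$ on $(-\delta,0)$ and on $(0,\delta)$. Assumption (B) for a function $g$ on $\Omega$ (or for the restriction to $\Omega$ of a function on $\Omega\cup\Omega_I$): $g$ has a jump discontinuity at $0$ (finite, distinct one-sided limits), $g$ is $C^N$ on $(a_1,0)$ and on $(0,a_2)$ for some $N\in\mathbb{N}$, and $g$ and its derivatives $g^{(j)}$, $j=1,\dots,N$, are bounded on $(a_1,a_2)$ (away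 from $0$). The jump of a function $\psi$ at $p$ is $[\psi]_p=\lim_{x\to p^+}\psi(x)-\lim_{x\to p^-}\psi(x)$, given that both one-sided limits exist; jump identities are asserted when the jumps are defined. Elements of $L^2$ are identified up to almost-everywhere equality. *)

(* Defs.v *)
(* MathComp / MathComp-Analysis *)
From HB Require Import structures.
From mathcomp Require Import all_boot all_order all_algebra.
From mathcomp Require Import all_classical all_reals all_analysis.

Set Implicit Arguments.
Unset Strict Implicit.
Unset Printing Implicit Defensive.

Import Order.TTheory GRing.Theory Num.Theory.
Import numFieldNormedType.Exports.

Local Open Scope classical_set_scope.
Local Open Scope ring_scope.

Section Definitions.
Context {R : realType}.
Implicit Types (a delta p s : R) (n k : nat) (A D : set R).
Implicit Types (g h psi u f K : R -> R).

Definition leb := @lebesgue_measure R.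

Definition Omega a1 a2 : set R := `]a1, a2[.

Definition Omega_I a1 a2 delta : set R :=
  `]a1 - delta, a1] `|` `[a2, a2 + delta[.

(* Functions of L^2(D) are represented by functions on the whole line, whose
   values outside of D are irrelevant. *)
Definition in_L2 D g := g \_ D \in Lfun leb 2%:E.

(* The kernel is the one-variable function K, with K(x, y) = K(|x - y|). *)
Definition nonlocal D K u (x : R) : R :=
  \int[leb]_(y in D) ((u y - u x) * K `|x - y|).

Definition alpha K : R := fine 'N[leb]_1 [EFin \o K].

(* Meant for an open A, on which derive1n j g depends only on the values of g. *)
Definition Cn n A g :=
  (forall j x, (j < n)%N -> A x -> derivable (derive1n j g) x 1) /\
  {in A, continuous (derive1n n g)}.

Definition smooth_on A g := forall n, Cn n A g.

Definition compact_support g := compact (closure [set x | g x != 0]).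

Definition assumptionA1 a1 a2 delta K :=
  let D := Omega a1 a2 `|` Omega_I a1 a2 delta in
  [/\ forall z, K z = K `|z|,
      forall x y, D x -> D y -> 0 <= K `|x - y|,
      forall z, delta <= `|z| -> K z = 0 &
      K \in Lfun leb 1%:E].

Definition assumptionA2 delta K :=
  [/\ {within `[- delta, 0[ `|` `]0, delta], continuous K},
      smooth_on `]- delta, 0[ K &
      smooth_on `]0, delta[ K].

Definition jump_defined psi p :=
  cvg (psi x @[x --> p^'-]) /\ cvg (psi x @[x --> p^'+]).

Definition jump psi p : R :=
  lim (psi x @[x --> p^'+]) - lim (psi x @[x --> p^'-]).

(* Since g is an element of L^2, the regularity is that of a representative h
   of its almost-everywhere class on the interval. *)
Definition assumptionB a1 a2 g := exists h,
  [/\ h = g %[ae leb in Omega a1 a2],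
      jump_defined h 0 /\
        lim (h x @[x --> 0^'-]) <> lim (h x @[x --> 0^'+]) &
      exists N, [/\ (0 < N)%N,
        Cn N `]a1, 0[ h /\ Cn N `]0, a2[ h &
        forall j, (j <= N)%N ->
          [bounded (derive1n j h) x | x in `]a1, 0[ `|` `]0, a2[]]].

(* "The jump of g^(k) at p is defined and equal to s": some representative h
   of the almost-everywhere class of g on D is k times differentiable in a
   punctured neighbourhood of p, and its k-th derivative has jump s at p. The
   value s does not depend on h when D is a neighbourhood of p. *)
Definition deriv_jump D g k p s := exists h,
  [/\ h = g %[ae leb in D],
      \forall x \near p^', forall j, (j < k)%N -> derivable (derive1n j h) x 1,
      jump_defined (derive1n k h) p &
      jump (derive1n k h) p = s].

Definition deriv_jump_defined D g k p := exists s, deriv_jump D g k p s.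

End Definitions.

(* Main.v *)
Require Import Defs.
From HB Require Import structures.
From mathcomp Require Import all_boot all_order all_algebra.
From mathcomp Require Import all_classical all_reals all_analysis.
From mathcomp Require Import measurable_realfun.
From mathcomp Require Import ring lra.
Import Order.TTheory GRing.Theory Num.Theory.
Import numFieldNormedType.Exports.
Local Open Scope classical_set_scope.
Local Open Scope ring_scope.

(** Let [D], the union of [Omega] and [Omega_I], be the open interval with
    endpoints [a1 - delta] and [a2 + delta].
    The kernel vanishes at distance at least [delta] from [0], so for [x] in
    [Omega] the integral of [K (x - y)] over [y] in [D] is the whole mass
    [alpha] of [K], and
      [L u x = v x - alpha * u x], where [v x = \int_D u y * K (x - y) dy]
    ([nonlocal_convolution]). Being square integrable on a bounded interval,
    [u] is integrable there; being smooth and compactly supported, [K] has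
    bounded derivatives of every order. Differentiation under the integral
    sign then shows that [v] is smooth on the whole line with bounded
    derivatives ([smooth_bounded_convolution]), whatever the regularity of [u].

    Almost everywhere on [Omega] one thus has [f = v - alpha * u] and,
    equivalently, [u = alpha^-1 * v - alpha^-1 * f]: each of [f] and [u] is a
    nonzero multiple of the other plus a multiple of [v]. Such an operation
    preserves Assumption (B) ([assumptionB_linear_comb]), and it multiplies the
    jump of the [k]-th derivative by the factor in front of the rough function,
    because [v] has no jump ([deriv_jump_linear_comb]). The jump relation
    follows since the jump of a derivative does not depend on the
    representative ([deriv_jump_unique]). *)

(** * Iterated derivatives of linear combinations *)

Section Calculus.
Context {R : realType}.
Implicit Types (g h : R -> R) (A : set R).

(** [g] is infinitely differentiable on the line, and each of its derivatives
    (including [g] itself) is bounded there. *)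
Definition smooth_bounded g := forall n,
  (forall x, derivable (derive1n n g) x 1) /\
  (exists M : R, forall x, `|derive1n n g x| <= M).

(** Iterated derivatives are local. *)
Lemma derive1n_eq_on A g h n : open A -> {in A, g =1 h} ->
  {in A, derive1n n g =1 derive1n n h}.
Proof.
move=> oA gh; elim: n => [|n IH] x xA; first exact: gh.
rewrite !derive1nS !derive1E; apply: near_eq_derive.
near=> y; apply: IH; rewrite inE.
by near: y; apply: open_nbhs_nbhs; split => //; exact: set_mem.
Unshelve. all: by end_near. Qed.

Lemma derivable_linear_comb (a b : R) {g h} {x : R} :
  derivable g x 1 -> derivable h x 1 ->
  derivable (fun y => a * g y + b * h y) x 1.
Proof.
move=> dg dh; apply: (@derivableD _ _ _ (fun y => a *: g y) (fun y => b *: h y));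
  exact: derivableZ.
Qed.

Lemma derive1_linear_comb (a b : R) g h x : derivable g x 1 -> derivable h x 1 ->
  derive1 (fun y => a * g y + b * h y) x = a * derive1 g x + b * derive1 h x.
Proof.
move=> dg dh; rewrite !derive1E.
rewrite (@deriveD _ _ _ (fun y => a *: g y) (fun y => b *: h y)) ?deriveZ//;
  exact: derivableZ.
Qed.

(** Linearity at order [j] only needs the derivatives of [h] of order less
    than [k] to be differentiable, hence the range [j <= k]. *)
Lemma derive1n_linear_comb (a b : R) A g h k : open A -> smooth_bounded g ->
  (forall j x, (j < k)%N -> A x -> derivable (derive1n j h) x 1) ->
  forall j, (j <= k)%N -> {in A, derive1n j (fun x => a * g x + b * h x) =1
     fun x => a * derive1n j g x + b * derive1n j h x}.
Proof.
move=> oA sg dh; elim => [//|j IH] jk x xA; have Ax := set_mem xA.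
rewrite !derive1nS -derive1_linear_comb; [|exact: (sg j).1|exact: dh].
rewrite !derive1E; apply: near_eq_derive.
near=> y; apply: (IH (ltnW jk)).
by rewrite inE; near: y; exact: open_nbhs_nbhs.
Unshelve. all: by end_near. Qed.

Lemma derivable_derive1n_linear_comb (a b : R) A g h k : open A -> smooth_bounded g ->
  (forall j x, (j < k)%N -> A x -> derivable (derive1n j h) x 1) ->
  forall j x, (j < k)%N -> A x ->
  derivable (derive1n j (fun x => a * g x + b * h x)) x 1.
Proof.
move=> oA sg dh j x jk Ax.
apply: near_eq_derivable (derivable_linear_comb a b ((sg j).1 x) (dh _ _ jk Ax)).
near=> y; apply/esym/(derive1n_linear_comb a b A g h k oA sg dh); first exact: ltnW.
by rewrite inE; near: y; exact: open_nbhs_nbhs.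
Unshelve. all: by end_near. Qed.

Lemma Cn_linear_comb (a b : R) A g h n : open A -> smooth_bounded g -> Cn n A h ->
  Cn n A (fun x => a * g x + b * h x).
Proof.
move=> oA sg [dh ch].
split; first exact: derivable_derive1n_linear_comb.
move=> x xA; rewrite /continuous_at (derive1n_linear_comb a b A g h n oA sg dh n (leqnn n) _ xA).
have E : {near x, (fun x => a * derive1n n g x + b * derive1n n h x) =1
   derive1n n (fun x => a * g x + b * h x)}.
  near=> y; apply/esym/(derive1n_linear_comb a b A g h n oA sg dh n (leqnn n)).
  by rewrite inE; near: y; apply: open_nbhs_nbhs; split => //; exact: set_mem.
apply: cvg_trans (near_eq_cvg E) _.
apply: cvgD; (apply: cvgM; first exact: cvg_cst).
- by apply: differentiable_continuous; apply/derivable1_diffP; exact: (sg n).1.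
- exact: ch.
Unshelve. all: by end_near. Qed.

End Calculus.

(** * Convolution with a smooth kernel *)

Section Convolution.
Context {R : realType}.
Implicit Types (g h w phi : R -> R) (D : set (measurableTypeR R)).

(** Convolution of [phi] with the restriction of [w] to [D]. *)
Definition convolution D w phi (x : R) : R := \int[leb]_(y in D) (w y * phi (x - y)).

Lemma derivable_continuous phi : (forall x, derivable phi x 1) -> continuous phi.
Proof.
by move=> d x; apply: differentiable_continuous; apply/derivable1_diffP.
Qed.

Lemma derivable_subr (c x : R) : derivable (fun t : R => t - c) x 1.
Proof. by apply: derivableB; [exact: derivable_id|exact: derivable_cst]. Qed.

Lemma derive1_subr (c : R) : derive1 (fun t : R => t - c) = cst 1.
Proof.
apply/funext => x; rewrite derive1E (@deriveB _ _ _ id (cst c))//.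
by rewrite derive_id derive_cst subr0.
Qed.

Lemma smooth_bounded_vanishing (delta : R) phi :
  smooth_on setT phi -> (forall z, delta <= `|z| -> phi z = 0) ->
  smooth_bounded phi.
Proof.
move=> sphi phi0 n.
have dphi m x : derivable (derive1n m phi) x 1.
  by have [d _] := sphi m.+1; exact: d.
split; first exact: dphi.
(* The strict inequality gives an open set on which phi is locally zero; the
   remaining points form a compact interval. *)
have out x : delta < `|x| -> derive1n n phi x = 0.
  have oA : open [set x : R | delta < `|x|].
    by rewrite [X in open X](_ : _ = (fun x : R => `|x|) @^-1` [set t | delta < t])//;
      apply: open_comp; [move=> ? _; exact: norm_continuous|exact: open_gt].
  move=> dx; rewrite (derive1n_eq_on _ phi (cst 0) n oA) ?inE//.
    suff -> : derive1n n (cst 0 : R -> R) = cst 0 by [].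
    elim: n {dphi} => [//|n IH]; rewrite derive1nS IH.
    by apply/funext => z; rewrite derive1_cst.
  by move=> z /[!inE]/= /ltW/phi0.
(* `|delta| is used because delta is not assumed nonnegative. *)
have cphi : {within `[- `|delta|, `|delta|], continuous (derive1n n phi)}.
  exact/continuous_subspaceT/derivable_continuous.
have le : - `|delta| <= `|delta| by rewrite ge0_cp//.
have [cM _ HM] := EVT_max le cphi.
have [cm _ Hm] := EVT_min le cphi.
exists (`|derive1n n phi cM| + `|derive1n n phi cm|) => x.
have [xin|xout] := boolP (x \in `[- `|delta|, `|delta|]).
  have := HM _ xin; have := Hm _ xin => h1 h2.
  have := ler_norm (derive1n n phi cM); have := normr_ge0 (derive1n n phi cM).
  have := ler_norm (- derive1n n phi cm); have := normr_ge0 (derive1n n phi cm).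
  by rewrite normrN ler_norml; lra.
rewrite out ?normr0 ?addr_ge0//.
rewrite (le_lt_trans (ler_norm _))// ltNge ler_norml.
by move: xout; rewrite in_itv.
Qed.

Lemma integrable_convolution D w phi (x M : R) : measurable D ->
  leb.-integrable D (EFin \o w) -> continuous phi ->
  (forall z, `|phi z| <= M) ->
  leb.-integrable D (EFin \o (fun y => w y * phi (x - y))).
Proof.
move=> mD iw cphi M_ub.
suff H : leb.-integrable D (fun y => (w y)%:E * (phi (x - y)%R)%:E)%E.
  by apply: eq_integrable H.
apply: (@integrableMl _ _ _ _ _ mD _ (fun y => phi (x - y)) iw).
  apply: (measurable_funS measurableT) => //.
  apply: continuous_measurable_fun => y.
  apply: continuous_comp; last exact: cphi.
  by apply: cvgB; [exact: cvg_cst|exact: cvg_id].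
exists M; split; first exact: num_real.
by move=> t /ltW Mt y _ /=; exact: le_trans Mt.
Qed.

Lemma convolution_norm_le D w phi (x M : R) : measurable D ->
  leb.-integrable D (EFin \o w) -> continuous phi ->
  (forall z, `|phi z| <= M) ->
  `|convolution D w phi x| <= M * \int[leb]_(y in D) `|w y|.
Proof.
move=> mD iw cphi M_ub.
have ic := integrable_convolution D w phi x M mD iw cphi M_ub.
have iw' : leb.-integrable D (EFin \o (fun y => `|w y|)) by exact: integrable_norm.
apply: le_trans (le_normr_Rintegral mD ic) _.
rewrite -RintegralZl//; apply: le_Rintegral => //.
- exact: integrable_norm.
- by apply: (@eq_integrable _ _ _ _ _ mD (fun y => M%:E * (`|w y|)%:E)%E) => //;
    exact: integrableZl.
- by move=> y _; rewrite normrM mulrC ler_wpM2r.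
Qed.

(** The dominating function is [|M'| * |w|], uniformly in [x]. *)
Lemma convolution_derive1 D w phi (x M M' : R) : measurable D ->
  leb.-integrable D (EFin \o w) -> (forall z, derivable phi z 1) ->
  (forall z, `|phi z| <= M) -> (forall z, `|derive1 phi z| <= M') ->
  derivable (convolution D w phi) x 1 /\
  derive1 (convolution D w phi) x = convolution D w (derive1 phi) x.
Proof.
move=> mD iw dphi M_ub M'_ub.
pose F (x y : R) := w y * phi (x - y).
have dcomp (z y : R) : derivable (fun t => phi (t - y)) z 1.
  apply/derivable1_diffP/differentiable_comp; apply/derivable1_diffP.
  - exact: derivable_subr.
  - exact: dphi.
have dF (z y : R) : derivable (F ^~ y) z 1 by apply: derivableZ.
have d1F (z y : R) : partial1of2 F z y = w y * derive1 phi (z - y).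
  rewrite /partial1of2 derive1E (@deriveZ _ _ _ (fun t : R => phi (t - y)))//.
  rewrite -derive1E (@derive1_comp _ (fun t : R => t - y) phi)//.
  by rewrite derive1_subr mulr1.
pose G y := `|M'| * `|w y|.
have I : `]x - 1, x + 1[%classic x by rewrite /= in_itv/=; lra.
have iF z : `]x - 1, x + 1[%classic z -> leb.-integrable D (EFin \o F z).
  by move=> _; apply: integrable_convolution => //; exact: derivable_continuous.
have iG : leb.-integrable D (EFin \o G).
  apply: (@eq_integrable _ _ _ _ _ mD (fun y => (`|M'|)%:E * (`|w y|)%:E)%E) => //.
  by apply: integrableZl => //; exact: integrable_norm.
have G0 y : 0 <= G y by rewrite mulr_ge0.
have FG z y : `]x - 1, x + 1[%classic z -> D y -> `|partial1of2 F z y| <= G y.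
  move=> _ _; rewrite d1F normrM mulrC ler_wpM2r//.
  exact: le_trans (ler_norm _).
split.
  by apply: (derivable_under_integral mD I iF (fun z y _ _ => dF z y) G0 iG FG).
rewrite [LHS](differentiation_under_integral mD I iF (fun z y _ _ => dF z y) G0 iG FG).
by apply: eq_Rintegral => y _; rewrite d1F.
Qed.

Lemma derive1n_convolution D w phi n : measurable D ->
  leb.-integrable D (EFin \o w) -> smooth_bounded phi ->
  derive1n n (convolution D w phi) = convolution D w (derive1n n phi).
Proof.
move=> mD iw sphi; elim: n => [//|n IH]; rewrite !derive1nS IH.
have [d [M M_ub]] := sphi n; have [_ [M' M'_ub]] := sphi n.+1.
by apply/funext => x; have [] := convolution_derive1 D w _ x M M' mD iw d M_ub M'_ub.
Qed.

Lemma smooth_bounded_convolution D w phi : measurable D ->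
  leb.-integrable D (EFin \o w) -> smooth_bounded phi ->
  smooth_bounded (convolution D w phi).
Proof.
move=> mD iw sphi n; rewrite derive1n_convolution//.
have [d [M M_ub]] := sphi n; have [_ [M' M'_ub]] := sphi n.+1.
split=> [x|]; first by have [] := convolution_derive1 D w _ x M M' mD iw d M_ub M'_ub.
exists (M * \int[leb]_(y in D) `|w y|) => x.
by apply: convolution_norm_le => //; exact: derivable_continuous.
Qed.

(** Cauchy-Schwarz against the indicator of the bounded interval. *)
Lemma in_L2_integrable (c d : R) w : in_L2 `]c, d[ w ->
  leb.-integrable `]c, d[ (EFin \o w).
Proof.
move=> wL2.
have iL2 : (\1_(`]c, d[ : set R) : R -> R) \in Lfun (@lebesgue_measure R) 2%:E.
  rewrite inE; apply/andP; split; rewrite inE/=.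
    exact: measurable_indic.
  rewrite /finite_norm unlock; apply: poweR_lty.
  rewrite (eq_integral (fun x : measurableTypeR R => (\1_(`]c, d[ : set R) x)%:E)); last first.
    move=> x _; rewrite /= indicE; case: (x \in _) => /=.
      by rewrite normr1 powR1.
    by rewrite normr0 powR0.
  by rewrite integral_indic//= setIT lebesgue_measure_itv/=; case: ifP => // _; exact: ltry.
have := Lfun2_mul_Lfun1 wL2 iL2.
move=> /Lfun1_integrable => H.
apply/integrable_mkcond; first exact: measurable_itv.
apply: eq_integrable H => // x _.
rewrite /= patchE indicE; case: ifPn => xD; rewrite patchE ?xD ?(negbTE xD)/=.
  by rewrite mulr1.
by rewrite mulr0.
Qed.

(** For an even nonnegative [phi] such that [phi (x - y)] vanishes for [y]
    outside of the interval, this is the substitution [z = y - x]. *)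
Lemma L1norm_translate (c d x : R) phi : continuous phi ->
  (forall z, 0 <= phi z) -> (forall z, phi (- z) = phi z) ->
  (forall y, y <= c \/ d <= y -> phi (x - y) = 0) ->
  (\int[leb]_(y in `]c, d[) (phi (x - y))%:E = 'N[leb]_1 [EFin \o phi])%E.
Proof.
move=> cphi phi0 phiN out.
rewrite Lnorm1 [LHS]integral_mkcond.
rewrite [RHS](eq_integral (fun z : measurableTypeR R => (phi z)%:E)); last first.
  by move=> z _ /=; rewrite ger0_norm.
rewrite [RHS](@increasing_ge0_integration_by_substitutionT _ (fun y => y - x))//.
- apply: eq_integral => y _; rewrite derive1_subr patchE.
  have E : (phi (y - x) * 1)%:E = (phi (x - y))%:E by rewrite mulr1 -phiN opprB.
  apply: (etrans _ (esym E)).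
  case: ifPn => // yD; rewrite out//.
  by move: yD; rewrite notin_setE/= in_itv/= => /negP; rewrite negb_and -!leNgt => /orP.
- by move=> y z; rewrite ltrD2r.
- by rewrite derive1_subr; exact: cst_continuous.
- by rewrite derive1_subr; exact: is_cvg_cst.
- by rewrite derive1_subr; exact: is_cvg_cst.
- apply/cvgrNyPle => A; near=> y.
  by rewrite lerBlDr; near: y; apply: nbhs_ninfty_le; exact: num_real.
- apply/cvgryPge => A; near=> y.
  by rewrite lerBrDr; near: y; apply: nbhs_pinfty_ge; exact: num_real.
Unshelve. all: by end_near. Qed.
End Convolution.

(** * Jumps and almost-everywhere representatives *)

Section Transfer.
Context {R : realType}.
Implicit Types (f g h V phi : R -> R) (D A : set R).

Lemma dnbhs_at_right (p : R) (P : set R) :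
  (\forall x \near p^', P x) -> \forall x \near p^'+, P x.
Proof.
apply: (@filterS _ (nbhs p) _ (fun x => x != p -> P x) (fun x => p < x -> P x)).
by move=> x Px px; apply: Px; rewrite gt_eqF.
Qed.

Lemma dnbhs_at_left (p : R) (P : set R) :
  (\forall x \near p^', P x) -> \forall x \near p^'-, P x.
Proof.
apply: (@filterS _ (nbhs p) _ (fun x => x != p -> P x) (fun x => x < p -> P x)).
by move=> x Px px; apply: Px; rewrite lt_eqF.
Qed.

(** A property that holds near [p] but not necessarily at [p] holds on an open
    punctured neighbourhood of [p]. *)
Lemma dnbhs_open (p : R) (P : set R) : (\forall x \near p^', P x) ->
  exists A, [/\ open A, (\forall x \near p^', A x) & A `<=` P].
Proof.
move=> /nbhs_ballP[e /= e0 pe].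
exists (ball p e `&` ~` [set p]); split.
- apply: openI; first exact: ball_open.
  by apply: closed_openC; exact: accessible_closed_set1 (hausdorff_accessible (@Rhausdorff R)) _.
- apply/nbhs_ballP; exists e => //= x xe xp; split => // /eqP.
  exact/negP.
- by move=> x [xe] /eqP xp; exact: pe.
Qed.

Lemma smooth_bounded_cvg V n (p : R) (F : set_system R) {FF : Filter F} :
  smooth_bounded V -> F `=>` nbhs p ->
  derive1n n V x @[x --> F] --> derive1n n V p.
Proof.
move=> sV Fp; apply: (cvg_trans (cvg_app _ Fp)).
exact: (derivable_continuous _ (sV n).1).
Qed.

Lemma at_right_nbhs (p : R) : p^'+ `=>` nbhs p.
Proof. by move=> P; apply: (@filterS _ (nbhs p) _ P (fun x => p < x -> P x)). Qed.

Lemma at_left_nbhs (p : R) : p^'- `=>` nbhs p.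
Proof. by move=> P; apply: (@filterS _ (nbhs p) _ P (fun x => x < p -> P x)). Qed.

(** Used with the one-sided filters at [p]: only the term in [h] contributes
    differently to the two one-sided limits. *)
Lemma cvg_derive1n_linear_comb (a b l p : R) V h k (F : set_system R) {FF : Filter F} A :
  smooth_bounded V -> F `=>` nbhs p -> open A -> F A ->
  (forall j x, (j < k)%N -> A x -> derivable (derive1n j h) x 1) ->
  derive1n k h x @[x --> F] --> l ->
  derive1n k (fun x => a * V x + b * h x) x @[x --> F] -->
    a * derive1n k V p + b * l.
Proof.
move=> sV Fp oA FA dh hl.
have E : {near F, (fun x => a * derive1n k V x + b * derive1n k h x) =1
    derive1n k (fun x => a * V x + b * h x)}.
  apply: filterS FA => x Ax.
  by apply/esym/(derive1n_linear_comb a b A V h k oA sV dh k (leqnn k)); rewrite inE.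
apply: cvg_trans (near_eq_cvg E) _.
apply: cvgD; (apply: cvgM; first exact: cvg_cst) => //.
exact: smooth_bounded_cvg.
Qed.

(** Calculus of almost-everywhere equality for [leb]. *)
Lemma ae_eq_leb_trans f g h D :
  f = g %[ae leb in D] -> g = h %[ae leb in D] -> f = h %[ae leb in D].
Proof. exact: (@ae_eq_trans _ _ _ (@lebesgue_measure R)). Qed.

Lemma ae_eq_leb_sym f g D : f = g %[ae leb in D] -> g = f %[ae leb in D].
Proof. exact: (@ae_eq_sym _ _ _ (@lebesgue_measure R)). Qed.

Lemma ae_eq_leb_linear_comb (a b : R) D V g h : g = h %[ae leb in D] ->
  (fun x => a * V x + b * g x) = (fun x => a * V x + b * h x) %[ae leb in D].
Proof.
exact: (@ae_eq_comp2 _ _ _ (@lebesgue_measure R) _ _ _ (fun x y => a * V x + b * y)).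
Qed.

Lemma deriv_jump_linear_comb (a b p s : R) D V f g k : smooth_bounded V ->
  f = (fun x => a * V x + b * g x) %[ae leb in D] ->
  deriv_jump D g k p s -> deriv_jump D f k p (b * s).
Proof.
move=> sV fg [h [hg dh [cl cr] <-]].
have [A [oA pA AP]] := dnbhs_open _ _ dh.
have dhA j x : (j < k)%N -> A x -> derivable (derive1n j h) x 1.
  by move=> jk Ax; exact: (AP x Ax j jk).
pose proof (cvg_derive1n_linear_comb a b _ p V h k p^'+ A sV
  (@at_right_nbhs p) oA (dnbhs_at_right _ _ pA) dhA cr) as Hr.
pose proof (cvg_derive1n_linear_comb a b _ p V h k p^'- A sV
  (@at_left_nbhs p) oA (dnbhs_at_left _ _ pA) dhA cl) as Hl.
exists (fun x => a * V x + b * h x); split.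
- apply: ae_eq_leb_trans (ae_eq_leb_linear_comb _ _ _ _ _ _ hg) _.
  exact: ae_eq_leb_sym.
- near=> x => j jk.
  apply: (derivable_derive1n_linear_comb a b A V h k oA sV dhA) => //.
  by near: x.
- by split; apply/cvg_ex; eexists; [exact: Hl|exact: Hr].
- rewrite /jump (cvg_lim _ Hr)// (cvg_lim _ Hl)//; ring.
Unshelve. all: by end_near. Qed.

Lemma assumptionB_linear_comb (a b a1 a2 : R) V f g : b != 0 ->
  smooth_bounded V ->
  f = (fun x => a * V x + b * g x) %[ae leb in Omega a1 a2] ->
  assumptionB a1 a2 g -> assumptionB a1 a2 f.
Proof.
move=> b0 sV fg [h [hg [[cl cr] neq] [N [N0 [Cl Cr] bh]]]].
have dh0 j x : (j < 0)%N -> setT x -> derivable (derive1n j h) x 1.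
  by rewrite ltn0 => j0; discriminate j0.
pose proof (cvg_derive1n_linear_comb a b _ 0 V h 0 0^'+ setT sV
  (@at_right_nbhs 0) openT filterT dh0 cr) as Hr.
pose proof (cvg_derive1n_linear_comb a b _ 0 V h 0 0^'- setT sV
  (@at_left_nbhs 0) openT filterT dh0 cl) as Hl.
exists (fun x => a * V x + b * h x); split.
- apply: ae_eq_leb_trans (ae_eq_leb_linear_comb _ _ _ _ _ _ hg) _.
  exact: ae_eq_leb_sym.
- split; first by split; apply/cvg_ex; eexists; [exact: Hl|exact: Hr].
  rewrite (cvg_lim _ Hr)// (cvg_lim _ Hl)//.
  by move=> /addrI/(mulfI b0).
- exists N; split; first exact: N0.
    by split; apply: Cn_linear_comb; [exact: itv_open| |exact: Cl|exact: itv_open| |exact: Cr].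
  move=> j jN; have [_ [MV VM]] := sV j.
  have [M [_ hM]] := bh j jN.
  pose A : set R := `]a1, 0[ `|` `]0, a2[.
  have oA : open A by apply: openU; exact: itv_open.
  have dh i x : (i < N)%N -> A x -> derivable (derive1n i h) x 1.
    by move=> iN [xl|xr]; [exact: Cl.1|exact: Cr.1].
  exists (`|a| * MV + `|b| * (M + 1)); split; first exact: num_real.
  move=> t /ltW ltt x Ax; apply: le_trans ltt.
  rewrite /= (derive1n_linear_comb a b A V h N oA sV dh _ jN _ (mem_set Ax)).
  rewrite (le_trans (ler_normD _ _))// !normrM lerD// ler_wpM2l//.
  by apply: hM => //; rewrite ltrDl.
Unshelve. all: by end_near. Qed.

(** Limits of almost everywhere equal functions agree along any filter whose
    members all contain a nontrivial interval: if the limits were distinct, the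
    functions would differ on such an interval, which has positive measure. *)
Lemma ae_eq_cvg_unique D h1 h2 (l1 l2 : R) (F : set_system R) : Filter F ->
  (forall P, F P -> exists c d, c < d /\ `]c, d[ `<=` P) ->
  F D -> h1 = h2 %[ae leb in D] ->
  h1 x @[x --> F] --> l1 -> h2 x @[x --> F] --> l2 -> l1 = l2.
Proof.
move=> FF Fitv FD h12 hl1 hl2; apply/eqP/negPn/negP => l12.
have e0 : 0 < `|l1 - l2| / 2 by rewrite divr_gt0// normr_gt0 subr_eq0.
have [|c [d [cd cdP]]] := Fitv (fun x => [/\ D x, `|l1 - h1 x| < `|l1 - l2| / 2
    & `|l2 - h2 x| < `|l1 - l2| / 2]).
  near=> x; split; near: x => //.
  - by move/cvgrPdist_lt : hl1; exact.
  - by move/cvgrPdist_lt : hl2; exact.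
have [Z [mZ Z0 DZ]] := h12.
have cdZ : `]c, d[ `<=` Z.
  move=> x /cdP[Dx h1x h2x]; apply: DZ => /= /(_ Dx) E.
  have : `|l1 - l2| < `|l1 - l2|.
    rewrite [ltRHS]splitr (le_lt_trans _ (ltrD h1x h2x))//.
    by rewrite -E (distrC l2) -[in leLHS](subrKA (h1 x)) ler_normD.
  by rewrite ltxx.
have : (leb `]c, d[ <= leb Z)%E by apply: le_measure; rewrite ?inE.
by rewrite Z0 /leb lebesgue_measure_itv/= lte_fin cd -EFinB lee_fin subr_le0 leNgt cd.
Unshelve. all: by end_near. Qed.

Lemma at_right_itv (p : R) P : p^'+ P -> exists c d, c < d /\ `]c, d[ `<=` P.
Proof.
move=> /nbhs_ballP[e /= e0 pe]; exists p, (p + e); split; first by rewrite ltrDl.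
move=> x /=; rewrite in_itv/= => /andP[px xpe]; apply: pe => //.
by rewrite /ball/= distrC ger0_norm ?subr_ge0 ?ltW// ltrBlDl.
Qed.

Lemma at_left_itv (p : R) P : p^'- P -> exists c d, c < d /\ `]c, d[ `<=` P.
Proof.
move=> /nbhs_ballP[e /= e0 pe]; exists (p - e), p; split; first by rewrite ltrBlDr ltrDl.
move=> x /=; rewrite in_itv/= => /andP[px xpe]; apply: pe => //.
by rewrite /ball/= ger0_norm ?subr_ge0 ?ltW// ltrBlDr -ltrBlDl.
Qed.

(** For [k = 0] the one-sided limits of two representatives agree by
    [ae_eq_cvg_unique]. For [k > 0] both representatives are continuous on a
    punctured neighbourhood of [p], hence equal there, and so are their
    derivatives. *)
Lemma deriv_jump_unique D g k (p s1 s2 : R) : nbhs p D ->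
  deriv_jump D g k p s1 -> deriv_jump D g k p s2 -> s1 = s2.
Proof.
move=> pD [h1 [h1g dh1 [cl1 cr1] <-]] [h2 [h2g dh2 [cl2 cr2] <-]].
have h12 : h1 = h2 %[ae leb in D].
  exact: ae_eq_leb_trans h1g (ae_eq_leb_sym _ _ _ h2g).
suff E : k = 0%N \/ \forall x \near p^', derive1n k h1 x = derive1n k h2 x.
  case: E => [k0|E].
    rewrite /jump; move: cl1 cr1 cl2 cr2; rewrite k0 => cl1 cr1 cl2 cr2.
    congr (_ - _).
    - exact: (ae_eq_cvg_unique D h1 h2 _ _ _ _ (@at_right_itv p) (at_right_nbhs p _ pD)).
    - exact: (ae_eq_cvg_unique D h1 h2 _ _ _ _ (@at_left_itv p) (at_left_nbhs p _ pD)).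
  have Er : {near p^'+, derive1n k h2 =1 derive1n k h1}.
    by apply: dnbhs_at_right; apply: filterS E => x ->.
  have El : {near p^'-, derive1n k h2 =1 derive1n k h1}.
    by apply: dnbhs_at_left; apply: filterS E => x ->.
  rewrite /jump; congr (_ - _); apply: cvg_lim => //.
  - exact: cvg_trans (near_eq_cvg Er) cr2.
  - exact: cvg_trans (near_eq_cvg El) cl2.
case: k dh1 dh2 {cl1 cr1 cl2 cr2} => [|k] dh1 dh2; [by left|right].
have dh : \forall x \near p^', [/\ derivable h1 x 1, derivable h2 x 1 & nbhs x D].
  pose proof (nbhs_dnbhs (nbhs_interior pD)) as pD'.
  apply: filterS3 dh1 dh2 pD' => y d1 d2 yD.
  by split; [exact: (d1 0%N isT)|exact: (d2 0%N isT)|exact: yD].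
have [A [oA pA AP]] := dnbhs_open _ _ dh.
(* Two functions continuous at x and almost everywhere equal near x agree at
   x, as their values are their limits from the right. *)
have hA : {in A, h1 =1 h2}.
  move=> x /set_mem /AP[d1 d2 xD].
  apply: (ae_eq_cvg_unique D h1 h2 _ _ _ _ (@at_right_itv x) (at_right_nbhs x _ xD)) => //.
  - apply: cvg_trans (cvg_app _ (at_right_nbhs x)) _.
    exact: differentiable_continuous (proj1 (derivable1_diffP _ _) d1).
  - apply: cvg_trans (cvg_app _ (at_right_nbhs x)) _.
    exact: differentiable_continuous (proj1 (derivable1_diffP _ _) d2).
near=> x; apply: (derive1n_eq_on A) => //; rewrite inE.
by near: x.
Unshelve. all: by end_near. Qed.

End Transfer.

(** * The nonlocal operator *)

Section Kernel.
Context {R : realType}.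
Implicit Types (a delta : R) (K : R -> R).

Lemma Omega_setU (a1 a2 delta : R) : a1 < a2 -> 0 < delta ->
  Omega a1 a2 `|` Omega_I a1 a2 delta = `]a1 - delta, a2 + delta[%classic.
Proof.
move=> a12 d0; rewrite /Omega /Omega_I; apply/seteqP; split => x /=; rewrite !in_itv/=.
  move=> [/andP[h1 h2]|[/andP[h1 h2]|/andP[h1 h2]]]; apply/andP; split; lra.
move=> /andP[h1 h2].
have [xa1|xa1] := leP x a1; first by right; left; rewrite h1.
have [xa2|xa2] := ltP x a2; first by left.
by right; right.
Qed.

(** Nonnegativity is assumed at differences of points of the domain only;
    these include all distances less than [delta], and [K] vanishes beyond. *)
Lemma assumptionA1_ge0 (a1 a2 delta : R) K z : a1 < a2 -> 0 < delta ->
  assumptionA1 a1 a2 delta K -> 0 <= K z.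
Proof.
move=> a12 d0 KA1; have [Keven K0 Kout _] := KA1.
have [dz|zd] := leP delta `|z|; first by rewrite Kout.
rewrite Keven; move: (`|z|) (normr_ge0 z) zd => r r0 rd.
rewrite -(ger0_norm r0) (_ : r = (a1 + r) - a1); last by rewrite addrAC subrr add0r.
apply: K0; rewrite Omega_setU//= in_itv/=; apply/andP; split; lra.
Qed.

(** On [Omega] the operator is a convolution minus [alpha K] times the
    identity. *)
Lemma nonlocal_convolution (a1 a2 delta : R) (K u : R -> R) (x : R) : a1 < a2 -> 0 < delta ->
  assumptionA1 a1 a2 delta K -> smooth_bounded K -> Omega a1 a2 x ->
  leb.-integrable `]a1 - delta, a2 + delta[%classic (EFin \o u) ->
  nonlocal `]a1 - delta, a2 + delta[%classic K u x =
    convolution `]a1 - delta, a2 + delta[%classic u K x - alpha K * u x.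
Proof.
move=> a12 d0 KA1 sK Ox iu; have [Keven _ Kout _] := KA1.
have cK := derivable_continuous _ (sK 0%N).1.
have KN z : K (- z) = K z by rewrite Keven [in RHS]Keven normrN.
have [_ [M KM]] := sK 0%N.
move: Ox; rewrite /Omega /= in_itv/= => /andP[ax xa].
set D : set (measurableTypeR R) := `]a1 - delta, a2 + delta[%classic.
have mD : measurable D by exact: measurable_itv.
have intK : (\int[leb]_(y in D) (K (x - y))%:E = 'N[leb]_1 [EFin \o K])%E.
  apply: L1norm_translate => //; first by move=> z; exact: assumptionA1_ge0 KA1.
  by move=> y [ya|ya]; apply: Kout; [rewrite ger0_norm|rewrite ler0_norm]; lra.
have iD1 : leb.-integrable D (EFin \o (fun _ : R => 1 : R)).
  apply: (measurable_bounded_integrable mD); last exact: bounded_cst.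
    by rewrite /= /leb /D lebesgue_measure_itv/=; case: ifP => // _; rewrite -EFinB ltry.
  exact: measurable_cst.
have iuK : leb.-integrable D (EFin \o (fun y => u y * K (x - y))).
  exact: integrable_convolution iu cK KM.
have iK : leb.-integrable D (EFin \o (fun y => K (x - y))).
  apply: eq_integrable (integrable_convolution _ _ _ x M mD iD1 cK KM) => //.
  by move=> y _ /=; rewrite mul1r.
have iuxK : leb.-integrable D (EFin \o (fun y => u x * K (x - y))).
  exact: eq_integrable (integrableZl mD (u x) iK).
rewrite /nonlocal (@eq_Rintegral _ _ _ _ _ (fun y : measurableTypeR R =>
  u y * K (x - y) - u x * K (x - y))); last first.
  by move=> y _ /=; rewrite -Keven mulrBl.
rewrite RintegralB// RintegralZl// mulrC; congr (_ - _ * _).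
by rewrite /Rintegral intK.
Qed.

End Kernel.

Theorem theorem7 (R : realType) (a1 a2 delta : R) (K f u : R -> R)
    (Omega0 : (0 : R) \in Omega a1 a2) (delta_gt0 : 0 < delta)
    (alpha_gt0 : 0 < alpha K)
    (KA1 : assumptionA1 a1 a2 delta K) (KA2 : assumptionA2 delta K)
    (Ksmooth : smooth_on setT K) (Kcompact : compact_support K)
    (fL2 : in_L2 (Omega a1 a2) f)
    (uL2 : in_L2 (Omega a1 a2 `|` Omega_I a1 a2 delta) u)
    (Lu_f : nonlocal (Omega a1 a2 `|` Omega_I a1 a2 delta) K u = f
              %[ae leb in Omega a1 a2]) :
  (assumptionB a1 a2 f <-> assumptionB a1 a2 u) /\
  (forall k : nat,
     (deriv_jump_defined (Omega a1 a2) f k 0 <->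
        deriv_jump_defined (Omega a1 a2) u k 0) /\
     (forall jf ju : R,
        deriv_jump (Omega a1 a2) f k 0 jf ->
        deriv_jump (Omega a1 a2) u k 0 ju ->
        ju = - (1 / alpha K) * jf)).
Proof.
have O0 : Omega a1 a2 0 by exact: set_mem.
have a12 : a1 < a2.
  by move: (O0); rewrite /Omega/= in_itv/= => /andP[]; exact: lt_trans.
move: uL2 Lu_f; rewrite (Omega_setU _ _ _ a12 delta_gt0) => uL2 Lu_f.
have iu := in_L2_integrable _ _ _ uL2.
have [_ _ Kout _] := KA1.
have sK := smooth_bounded_vanishing _ _ Ksmooth Kout.
pose v := convolution `]a1 - delta, a2 + delta[%classic u K.
have sv : smooth_bounded v.
  by apply: smooth_bounded_convolution => //; exact: measurable_itv.
have Luv : nonlocal `]a1 - delta, a2 + delta[%classic K u =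
    (fun x => 1 * v x + - alpha K * u x) %[ae leb in Omega a1 a2].
  apply: (@aeW _ _ _ (@lebesgue_measure R)) => x Ox.
  by rewrite (nonlocal_convolution _ _ _ _ _ _ a12 delta_gt0 KA1)// mul1r mulNr.
have fu : f = (fun x => 1 * v x + - alpha K * u x) %[ae leb in Omega a1 a2].
  exact: ae_eq_leb_trans (ae_eq_leb_sym _ _ _ Lu_f) Luv.
have al0 : alpha K != 0 by rewrite gt_eqF.
have uf : u = (fun x => (alpha K)^-1 * v x + - (1 / alpha K) * f x)
    %[ae leb in Omega a1 a2].
  apply: ae_eq_leb_sym.
  apply: ae_eq_leb_trans (ae_eq_leb_linear_comb _ _ _ _ _ _ fu) _.
  apply: (@aeW _ _ _ (@lebesgue_measure R)) => x _; field.
  exact: al0.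
have na0 : - alpha K != 0 by rewrite oppr_eq0.
have nia0 : - (1 / alpha K) != 0 by rewrite oppr_eq0 div1r invr_eq0.
split.
  by split; [exact: assumptionB_linear_comb uf|exact: assumptionB_linear_comb fu].
move=> k; split.
  split=> -[s js]; eexists.
    exact: deriv_jump_linear_comb sv uf js.
  exact: deriv_jump_linear_comb sv fu js.
move=> jf ju /(deriv_jump_linear_comb _ _ _ _ _ _ _ _ _ sv uf) jf' ju'.
apply: deriv_jump_unique ju' jf'.
by apply: open_nbhs_nbhs; split => //; exact: itv_open.
Qed.
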